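(* Let $f:\mathbb{R}^n\to\mathbb{R}^n$, $f=(f_1,\dots,f_n)^T$, and let $\phi:\mathbb{R}\to\mathbb{R}$ be any increasing function such that $\phi(0)=0$. Then a vector $z=(z_1,\dots,z_n)^T\in\mathbb{R}^n$ solves the complementarity problem $$z^Tf(z)=0,\qquad f(z)\ge 0,\qquad z\ge 0$$ if and only if, for every $i\in\{1,\dots,n\}$, $$\phi\big((f_i(z)-z_i)^2\big)-\phi\big(f_i(z)\,|f_i(z)|\big)-\phi\big(z_i|z_i|\big)=0 .$$
   Context: Inequalities between vectors are understood componentwise. *)

(* Defs.v *)
From HB Require Import structures.
From mathcomp Require Import all_boot all_order all_algebra.
From mathcomp Require Import reals.

Set Implicit Arguments.
Unset Strict Implicit.
Unset Printing Implicit Defensive.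

Import Order.TTheory GRing.Theory Num.Theory.
Local Open Scope ring_scope.

Definition nonneg_vec (R : realType) (n : nat) (x : 'cV[R]_n) : Prop :=
  forall i : 'I_n, 0 <= x i 0.

(* z^T f(z) is a 1 x 1 matrix, so the 0 below is the zero of 'M[R]_1. *)
Definition solves_CP (R : realType) (n : nat) (f : 'cV[R]_n -> 'cV[R]_n)
    (z : 'cV[R]_n) : Prop :=
  [/\ z^T *m f z = 0, nonneg_vec (f z) & nonneg_vec z].

(* "Increasing" is strict: with a merely nondecreasing function such as 0, the
   equations characterizing complementarity would hold at every z. *)
Definition increasing_fun (R : realType) (phi : R -> R) : Prop :=
  {homo phi : x y / x < y}.

(* Main.v *)
(* Write a = f_i(z) and b = z_i.  If a < 0 then (a - b)^2 >= b|b| while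
   phi(a|a|) < 0, so the left-hand side of the i-th equation is positive.  If
   0 < b <= a then (a - b)^2 < a^2 and phi(b^2) > 0, so it is negative.  By
   symmetry in a and b, a zero forces a, b >= 0 and ab = 0. *)

Require Import Defs.
From HB Require Import structures.
From mathcomp Require Import all_boot all_order all_algebra.
From mathcomp Require Import reals.
From mathcomp Require Import lra.

Set Implicit Arguments.
Unset Strict Implicit.
Unset Printing Implicit Defensive.

Import Order.TTheory GRing.Theory Num.Theory.
Local Open Scope ring_scope.

Section ScalarEquation.

Variables (R : realType) (phi : R -> R).
Hypotheses (phi_incr : increasing_fun phi) (phi0 : phi 0 = 0).

Let phi_le : {homo phi : x y / x <= y} := ltW_homo phi_incr.

Lemma scalar_eq_ge0 (a b : R) :
  phi ((a - b) ^+ 2) - phi (a * `|a|) - phi (b * `|b|) = 0 -> 0 <= a.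
Proof.
move=> eq0; case: (lerP 0 a) => // a_lt0.
have phia : phi (a * `|a|) < 0.
  by rewrite -phi0; apply: phi_incr; rewrite nmulr_rlt0 // normr_gt0 lt_eqF.
have phib : phi (b * `|b|) <= phi ((a - b) ^+ 2).
  (* If [b >= 0], then [a - b < -b <= 0], so the square exceeds [b ^+ 2]; if [b < 0], then [b * |b|]
     is negative and lies below any square. *)
  by apply: phi_le; case: (ger0P b) => b0; nra.
lra.
Qed.

Lemma scalar_eq_mul0 (a b : R) : 0 <= b <= a ->
  phi ((a - b) ^+ 2) - phi (a * `|a|) - phi (b * `|b|) = 0 -> a * b = 0.
Proof.
case/andP; rewrite le_eqVlt => /predU1P[<- _ _|b_gt0 ba]; first by rewrite mulr0.
rewrite !gtr0_norm ?(lt_le_trans b_gt0) // => eq0.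
have phib : 0 < phi (b * b) by rewrite -phi0; apply: phi_incr; rewrite mulr_gt0.
(* Here [a ^+ 2 - (a - b) ^+ 2 = b * (2 * a - b)], and both factors are positive. *)
have phia : phi ((a - b) ^+ 2) < phi (a * a) by apply: phi_incr; nra.
exfalso; lra.
Qed.

(** With [a] for [f z i 0] and [b] for [z i 0], the product [b * a] is the [i]-th term of
    [z^T *m f z]. *)
Lemma scalar_eqP (a b : R) :
  phi ((a - b) ^+ 2) - phi (a * `|a|) - phi (b * `|b|) = 0 <->
  [/\ b * a = 0, 0 <= a & 0 <= b].
Proof.
split=> [eq0|[/eqP + a_ge0 b_ge0]]; last first.
  (* Once [a] or [b] is 0, [(a - b) ^+ 2] is the square of the other, so two [phi] terms cancel and
     [phi 0] remains. *)
  rewrite !ger0_norm // mulf_eq0 => /orP[] /eqP->.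
    by rewrite mulr0 phi0 !subr0 expr2 subrr.
  by rewrite mulr0 phi0 sub0r sqrrN expr2 subr0 subrr.
have eq0' : phi ((b - a) ^+ 2) - phi (b * `|b|) - phi (a * `|a|) = 0.
  by rewrite -sqrrN opprB addrAC.
have a_ge0 := scalar_eq_ge0 eq0; have b_ge0 := scalar_eq_ge0 eq0'.
split=> //; case: (lerP b a) => [ba|/ltW ab].
  by rewrite mulrC; apply: scalar_eq_mul0 => //; rewrite b_ge0.
by apply: scalar_eq_mul0 => //; rewrite a_ge0.
Qed.

End ScalarEquation.

(** A sum of nonnegative terms vanishes only when each term does; this splits the single equation
    [z^T *m f z = 0] into coordinates. *)
Lemma nonneg_dot_eq0 (R : realType) (n : nat) (x y : 'cV[R]_n) :
  nonneg_vec x -> nonneg_vec y ->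
  x^T *m y = 0 <-> forall i, x i 0 * y i 0 = 0.
Proof.
move=> x_ge0 y_ge0; split=> [/matrixP/(_ 0 0)|xy0].
  rewrite !mxE => /eqP; rewrite psumr_eq0 => [/allP xy0 i|i _].
    by have := xy0 i (mem_index_enum i); rewrite mxE => /eqP.
  by rewrite mxE mulr_ge0.
by apply/matrixP => i j; rewrite !ord1 !mxE big1 // => k _; rewrite mxE.
Qed.

Theorem theorem1 (R : realType) (n : nat) (f : 'cV[R]_n -> 'cV[R]_n)
    (phi : R -> R) (phi_incr : increasing_fun phi) (phi0 : phi 0 = 0)
    (z : 'cV[R]_n) :
  solves_CP f z <->
  (forall i : 'I_n,
     phi ((f z i 0 - z i 0) ^+ 2) - phi (f z i 0 * `|f z i 0|)
       - phi (z i 0 * `|z i 0|) = 0).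
Proof.
split=> [[zf fz_ge0 z_ge0] i|eqs].
  by apply/scalar_eqP => //; split=> //; apply/nonneg_dot_eq0: i.
have sol i := (scalar_eqP phi_incr phi0 _ _).1 (eqs i).
have fz_ge0 : nonneg_vec (f z) by move=> i; case: (sol i).
have z_ge0 : nonneg_vec z by move=> i; case: (sol i).
by split=> //; apply/nonneg_dot_eq0 => // i; case: (sol i).
Qed.
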